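(* Let $R$ be a commutative ring with identity and $n\geq 2$. Suppose that $A,B\in M_n(R)$ share the first $n-1$ columns (that is, the $j$-th column of $A$ equals the $j$-th column of $B$ for $1\leq j\leq n-1$). Then $R[A,B]=R\langle A,B\rangle=R[B,A]$. In particular, this holds when $A=C$ and $B=D$ are the companion matrices of monic polynomials $f,g\in R[X]$ of degree $n$.
   Context: For $A,B\in M_n(R)$, $R\langle A,B\rangle$ denotes the (unital) $R$-subalgebra of $M_n(R)$ generated by $A$ and $B$, and $R[A,B]$ denotes the $R$-submodule of $M_n(R)$ spanned by all products $A^iB^j$ with $i,j\geq 0$ (so $R[B,A]$ is the $R$-span of all $B^iA^j$, $i,j\ge 0$). The companion matrix of a monic polynomial $f=f_0+f_1X+\cdots+f_{n-1}X^{n-1}+X^n\in R[X]$ is the matrix in $M_n(R)$ whose $j$-th column is $e_{j+1}$ for $1\leq j\leq n-1$ and whose last column is $(-f_0,-f_1,\dots,-f_{n-1})^t$, where $e_1,\dots,e_n$ is the canonical basis of the column space $R^n$. *)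

(* Defs.v *)
From HB Require Import structures.
From mathcomp Require Import all_boot all_order all_algebra.
From mathcomp Require Import classical_sets.

Set Implicit Arguments.
Unset Strict Implicit.
Unset Printing Implicit Defensive.

Import GRing.Theory.
Local Open Scope ring_scope.
Local Open Scope classical_set_scope.

Definition mx_span (R : comPzRingType) (n : nat) (G : set 'M[R]_n) :
    set 'M[R]_n :=
  smallest (fun S : set 'M[R]_n => GRing.submod_closed [in S]) G.

(* [GRing.subalg_closed] unfolded: its ambient [lalgType] structure on square
   matrices requires 1 != 0 in R and a dimension of the form n.+1. *)
Definition mx_subalg_closed (R : comPzRingType) (n : nat) (S : set 'M[R]_n) :
    Prop :=
  [/\ 1 \in S, GRing.linear_closed [in S] & GRing.mulr_2closed [in S]].

(* The unital R-subalgebra R<A, B> of M_n(R) *)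
Definition mx_alg2 (R : comPzRingType) (n : nat) (A B : 'M[R]_n) :
    set 'M[R]_n :=
  smallest (@mx_subalg_closed R n) [set A; B].

(* R[A, B]; the order of the arguments matters *)
Definition mx_ordspan (R : comPzRingType) (n : nat) (A B : 'M[R]_n) :
    set 'M[R]_n :=
  mx_span [set M | exists i j : nat, M = A ^+ i *m B ^+ j].

(* Coefficients in the last column and ones on the subdiagonal: this is the
   transpose of [companionmx f], with the dimension n as a parameter, to be
   used when f is monic of degree n. *)
Definition companion (R : comNzRingType) (n : nat) (f : {poly R}) : 'M[R]_n :=
  \matrix_(i < n, j < n)
    if j == n.-1 :> nat then - f`_i else (i == j.+1 :> nat)%:R.

(* Main.v *)
Require Import Defs.
From HB Require Import structures.
From mathcomp Require Import all_boot all_order all_algebra.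
From mathcomp Require Import classical_sets.

Set Implicit Arguments.
Unset Strict Implicit.
Unset Printing Implicit Defensive.

Import GRing.Theory.
Local Open Scope ring_scope.

(** If [A] and [B] share all columns but the last, then [Q := A - B] is supported
    on one column, so that [Q X Q] is a scalar multiple of [Q] for every [X].
    Expanding [A^(i+1) - B^(i+1) = \sum_k B^k Q A^(i-k)] and multiplying by [Q] on
    the left gives, by induction on [i], that [Q A^i] is a combination of the
    [Q B^j = A B^j - B^(j+1)]. Hence [B A^i = A^(i+1) - Q A^i] lies in
    [R[A, B]], which is therefore stable under left multiplication by [B]. *)

Section Span.

Local Open Scope classical_set_scope.

Context (R : comPzRingType) (n : nat).
Implicit Types (G S : set 'M[R]_n) (A B M N X : 'M[R]_n).

Lemma mx_span_ge G : G `<=` mx_span G.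
Proof. exact: sub_gen_smallest. Qed.

Lemma mx_span0 G : mx_span G 0.
Proof. by move=> S [[S0 _] _]; rewrite -in_setE. Qed.

Lemma mx_spanZD G a M N : mx_span G M -> mx_span G N -> mx_span G (a *: M + N).
Proof.
move=> GM GN S SG; have [[_ linS] _] := SG.
by rewrite -in_setE linS // in_setE; [apply: GM | apply: GN].
Qed.

Lemma mx_spanZ G a M : mx_span G M -> mx_span G (a *: M).
Proof. by move=> GM; rewrite -[_ *: _]addr0; exact: mx_spanZD GM (@mx_span0 G). Qed.

Lemma mx_spanD G M N : mx_span G M -> mx_span G N -> mx_span G (M + N).
Proof. by move=> GM GN; rewrite -[M]scale1r; exact: mx_spanZD. Qed.

Lemma mx_spanB G M N : mx_span G M -> mx_span G N -> mx_span G (M - N).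
Proof. by move=> GM GN; rewrite addrC -scaleN1r; exact: mx_spanZD. Qed.

Lemma mx_span_sum G m (F : 'I_m -> 'M[R]_n) :
  (forall k, mx_span G (F k)) -> mx_span G (\sum_k F k).
Proof.
by move=> GF; elim/big_ind: _ => [|M N|k _] //; [exact: mx_span0|exact: mx_spanD].
Qed.

(** The preimage of [mx_span G'] under [f] is a submodule, so it contains [mx_span G] once it
    contains [G]. This reduces the closure properties below to generators. *)
Lemma mx_span_linear_ind G (f : {linear 'M[R]_n -> 'M[R]_n}) G' :
  (forall M, G M -> mx_span G' (f M)) -> forall M, mx_span G M -> mx_span G' (f M).
Proof.
move=> GG' M /(_ (f @^-1` mx_span G')); apply; split => //; split.
  by rewrite in_setE /= linear0; exact: mx_span0.
move=> a X Y; rewrite !in_setE /= linearP; exact: mx_spanZD.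
Qed.

Lemma mx_ordspan_exp A B i j : mx_ordspan A B (A ^+ i *m B ^+ j).
Proof. by apply: mx_span_ge; exists i, j. Qed.

Lemma mx_ordspan_mull A B M : mx_ordspan A B M -> mx_ordspan A B (A *m M).
Proof.
apply: (@mx_span_linear_ind _ (mulmx A)) => _ [i [j ->]] /=.
by rewrite mulmxA -[A *m _]/(A * A ^+ i) -exprS; exact: mx_ordspan_exp.
Qed.

Lemma mx_ordspan_mulr A B M : mx_ordspan A B M -> mx_ordspan A B (M *m B).
Proof.
apply: (@mx_span_linear_ind _ (mulmxr B)) => _ [i [j ->]] /=.
by rewrite -mulmxA -[B ^+ j *m B]/(B ^+ j * B) -exprSr; exact: mx_ordspan_exp.
Qed.

Lemma mx_alg2C A B : mx_alg2 A B = mx_alg2 B A.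
Proof. by rewrite /mx_alg2 setUC. Qed.

Lemma mx_ordspan_sub A B : mx_ordspan A B `<=` mx_alg2 A B.
Proof.
move=> M spM S [[S1 linS mulS] /subsetP sABS].
have S_A : A \in S by apply: sABS; rewrite in_setE; left.
have S_B : B \in S by apply: sABS; rewrite in_setE; right.
have S_exp X k : X \in S -> X ^+ k \in S.
  by move=> SX; elim: k => [|k IHk]; rewrite ?exprS ?mulS.
apply: spM; split; last first.
  by move=> _ [i [j ->]]; rewrite -in_setE; apply: mulS; exact: S_exp.
(* Membership of 0 comes from writing it as [-1 *: 1 + 1]. *)
by split=> //; rewrite -(addNr 1) -scaleN1r linS.
Qed.

Section RankOne.

Variables (A B : 'M[R]_n).
Hypothesis sandwich :
  forall X, exists c, (A - B) *m X *m (A - B) = c *: (A - B).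

Lemma mx_ordspan_subl_exp i : mx_ordspan A B ((A - B) *m A ^+ i).
Proof.
(* Strong induction: the expansion below involves every exponent smaller than [i]. *)
elim/ltn_ind: i => i IHi.
have -> : (A - B) *m A ^+ i =
    (A - B) *m B ^+ i + (A - B) *m (A ^+ i - B ^+ i).
  by rewrite -mulmxDr [B ^+ i + _]addrC subrK.
apply: mx_spanD.
  rewrite mulmxBl; apply: mx_spanB; first exact: (@mx_ordspan_exp A B 1 i).
  rewrite -[B *m _]/(B * B ^+ i) -exprS -[B ^+ i.+1]mul1mx.
  exact: (@mx_ordspan_exp A B 0 i.+1).
have -> : A ^+ i - B ^+ i = \sum_(k < i) B ^+ k *m ((A - B) *m A ^+ (i - k.+1)).
  elim: i {IHi} => [|i IHi]; first by rewrite big_ord0 subrr.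
  (* The term for [k = 0] is [(A - B) *m A ^+ i]; the others share a left factor [B], which leaves
     the sum for [i]. *)
  rewrite big_ord_recl /= expr0 mul1mx subn1 /=.
  under eq_bigr => k _.
    rewrite /bump /= add1n exprS subSS -[B * _ ^+ _]/(B *m _) -mulmxA.
  over.
  rewrite -mulmx_sumr -IHi mulmxBl mulmxBr !exprS.
  by rewrite addrA subrK.
rewrite mulmx_sumr; apply: mx_span_sum => k.
(* The second factor [A - B] is absorbed into a scalar, leaving a multiple of
   [(A - B) *m A ^+ (i - k.+1)]. *)
have [c Dc] := sandwich (B ^+ k); rewrite !mulmxA Dc -scalemxAl.
by apply: mx_spanZ; apply: IHi; rewrite ltn_subrL (leq_ltn_trans _ (ltn_ord k)).
Qed.

Lemma mx_ordspan_mulBl M : mx_ordspan A B M -> mx_ordspan A B (B *m M).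
Proof.
apply: (@mx_span_linear_ind _ (mulmx B)) => _ [i [j ->]] /=.
(* Stability under right multiplication by [B] reduces the claim to [j = 0]. *)
rewrite mulmxA; elim: j => [|j IHj]; last first.
  by rewrite exprSr -[_ * B]/(_ *m B) mulmxA; exact: mx_ordspan_mulr.
have -> : B *m A ^+ i *m B ^+ 0 = A *m A ^+ i - (A - B) *m A ^+ i.
  by rewrite mulmx1 -mulmxBl opprB addrC subrK.
apply: mx_spanB; last exact: mx_ordspan_subl_exp.
rewrite -[A *m _]/(A * A ^+ i) -exprS -[A ^+ _]mulmx1.
exact: (@mx_ordspan_exp A B i.+1 0).
Qed.

Lemma mx_ordspan_mul M N :
  mx_ordspan A B M -> mx_ordspan A B N -> mx_ordspan A B (M *m N).
Proof.
move=> spM spN; move: M spM.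
apply: (@mx_span_linear_ind _ (mulmxr N)) => _ [i [j ->]] /=.
(* With [M] a generator, its factors [A] and then [B] are moved onto [N] one at a time from the
   left. *)
rewrite -mulmxA; elim: i => [|i IHi]; last first.
  by rewrite exprS -[A * _]/(A *m _) -mulmxA; exact: mx_ordspan_mull.
rewrite mul1mx; elim: j => [|j IHj]; first by rewrite mul1mx.
by rewrite exprS -[B * _]/(B *m _) -mulmxA; exact: mx_ordspan_mulBl.
Qed.

Lemma mx_ordspan_alg2 : mx_ordspan A B = mx_alg2 A B.
Proof.
apply/seteqP; split; first exact: mx_ordspan_sub.
apply: smallest_sub; first split.
- by rewrite in_setE -[1]mulmx1; exact: (@mx_ordspan_exp A B 0 0).
- by move=> a M N; rewrite !in_setE; exact: mx_spanZD.
- by move=> M N; rewrite !in_setE; exact: mx_ordspan_mul.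
- move=> _ [] ->.
    by rewrite -[X in mx_ordspan _ _ X]mulmx1; exact: (@mx_ordspan_exp A B 1 0).
  by rewrite -[X in mx_ordspan _ _ X]mul1mx; exact: (@mx_ordspan_exp A B 0 1).
Qed.

End RankOne.

End Span.

(** Only the summand [Q i l * (X *m Q) l j] survives in entry [(i, j)] of the product, and it
    vanishes unless [j = l]; hence the scalar [(X *m Q) l l]. *)
Lemma sandwich_col (R : comPzRingType) (n : nat) (Q X : 'M[R]_n) (l : 'I_n) :
  (forall i j, j != l -> Q i j = 0) -> exists c, Q *m X *m Q = c *: Q.
Proof.
move=> Q0; exists ((X *m Q) l l); apply/matrixP => i j.
rewrite -mulmxA mxE mxE (bigD1 l) //= big1 => [|k kl]; last by rewrite Q0 ?mul0r.
rewrite addr0; have [->|jl] := eqVneq j l; first exact: mulrC.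
rewrite (Q0 i j jl) mulr0 mxE big1 ?mulr0 // => k _.
by rewrite Q0 ?mulr0.
Qed.

Lemma mx_ordspan_share (R : comPzRingType) (n : nat) (A B : 'M[R]_n) :
  (0 < n)%N -> (forall j : 'I_n, (j < n.-1)%N -> col j A = col j B) ->
  mx_ordspan A B = mx_alg2 A B.
Proof.
case: n A B => // n A B _ eqAB; apply: mx_ordspan_alg2 => X.
apply: (@sandwich_col _ _ _ _ ord_max) => i j jn.
have /eqAB/colP/(_ i) : (j < n)%N by rewrite ltn_neqAle jn -ltnS ltn_ord.
by rewrite !mxE => ->; rewrite subrr.
Qed.

Theorem corollary6p3 (n : nat) (hn : (2 <= n)%N) :
  (forall (R : comPzRingType) (A B : 'M[R]_n),
     (forall j : 'I_n, (j < n.-1)%N -> col j A = col j B) ->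
     mx_ordspan A B = mx_alg2 A B /\ mx_alg2 A B = mx_ordspan B A) /\
  (forall (R : comNzRingType) (f g : {poly R}),
     f \is monic -> size f = n.+1 -> g \is monic -> size g = n.+1 ->
     let C := companion n f in
     let D := companion n g in
     mx_ordspan C D = mx_alg2 C D /\ mx_alg2 C D = mx_ordspan D C).
Proof.
have n_gt0 : (0 < n)%N := ltnW hn.
have share (R : comPzRingType) (A B : 'M[R]_n) :
    (forall j : 'I_n, (j < n.-1)%N -> col j A = col j B) ->
    mx_ordspan A B = mx_alg2 A B /\ mx_alg2 A B = mx_ordspan B A.
  move=> eqAB; split; first exact: mx_ordspan_share.
  (* Both the hypothesis and the generated algebra are symmetric in [A] and [B]. *)
  by rewrite mx_alg2C mx_ordspan_share // => j jn; rewrite eqAB.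
split=> // R f g _ _ _ _ C D; apply: share => j jn.
(* Before the last column, the entries of a companion matrix do not depend on the polynomial. *)
by apply/colP => i; rewrite !mxE ltn_eqF.
Qed.
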